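(* (First part.) Let $V=V_1\cup\dots\cup V_r$, $r\geq 3$, be a reducible surface in $\mathbb{P}^n$ with irreducible components $V_1,\dots,V_r$, such that $\dim[Sec(V)]\leq 4$ and $\dim\langle V\rangle\geq 5$. Assume that $\dim\langle V_i\rangle\leq 3$ for $i=1,\dots,r$ and $\dim\langle V_i\cup V_j\rangle\leq 4$ for any $i,j=1,\dots,r$. Then either $V$ is a union of planes pairwise intersecting at least at a point, or, after reordering the components, $V=V_1\cup\dots\cup V_t\cup\dots\cup V_r$ with $1\leq t\leq r$ such that: i) $\dim\langle V_i\rangle=3$ for any $1\leq i\leq t$, and $V_i$ is a plane for $t+1\leq i\leq r$ (if any); ii) $\dim(\langle V_i\rangle\cap\langle V_j\rangle)\geq 2$ for any $i,j=1,\dots,t$; $\dim(\langle V_i\rangle\cap V_j)\geq 1$ for any $i=1,\dots,t$ and $j=t+1,\dots,r$; $\dim(V_i\cap V_j)\geq 0$ for any $i,j=t+1,\dots,r$. (Second part.) Conversely, let $V=V_1\cup\dots\cup V_r$, $r\geq 3$, be a reducible surface in $\mathbb{P}^n$ with irreducible components $V_1,\dots,V_r$ such that $\dim\langle V\rangle\geq 5$. Assume that $\dim\langle V_i\rangle\leq 3$ for $i=1,\dots,r$ and that $V$ is either a union of planes pairwise intersecting at least at a point, or $V=V_1\cup\dots\cup V_t\cup\dots\cup V_r$ with $1\leq t\leq r$ satisfying conditions i) and ii) of the first part. Then $\dim[Sec(V)]\leq 4$.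
   Context: $\mathbb{P}^n$ is complex projective $n$-space. A variety is a reduced subvariety of $\mathbb{P}^n$ of pure dimension (possibly reducible); a surface is a variety of dimension $2$. $\langle M\rangle$ denotes the linear span of $M$. For distinct irreducible subvarieties $A,B$, $[A;B]$ is the closure of the union of the lines $\langle a\cup b\rangle$, $a\in A$, $b\in B$, $a\neq b$; $[A;A]=Sec(A)$ is the closure of the union of the lines joining two distinct points of $A$. For reducible $V=V_1\cup\dots\cup V_r$, $Sec(V)=\bigcup_{i,j}[V_i;V_j]$ (including $i=j$). The condition $\dim(M)\geq 0$ means $M\neq\emptyset$. *)

(* Defs.v *)
From mathcomp Require Import all_boot all_order all_algebra all_fingroup.
From mathcomp Require Import boolp classical_sets reals.
From mathcomp.real_closed Require Import complex.
From mathcomp Require Import mpoly.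

Set Implicit Arguments.
Unset Strict Implicit.
Unset Printing Implicit Defensive.

Import GRing.Theory.
Local Open Scope ring_scope.
Local Open Scope classical_set_scope.

(* Complex projective n-space: the points are the lines through the origin
   of C^(n+1), where C = R[i]. *)
Definition proj_space (R : realType) (n : nat) : Type :=
  {U : {vspace 'rV[R[i]]_n.+1} | \dim U == 1%N}.

Section Zariski.
Variables (R : realType) (n : nat).
Implicit Types A B M Z : set (proj_space R n).

Definition vanishes (f : {mpoly R[i][n.+1]}) (p : proj_space R n) : Prop :=
  forall v : 'rV[R[i]]_n.+1, v \in val p -> f.@[fun i => v 0 i] = 0.

Definition zclosed Z : Prop :=
  exists S : set {mpoly R[i][n.+1]},
    (forall f, S f -> exists d : nat, f \is d.-homog) /\
    Z = [set p | forall f, S f -> vanishes f p].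

Definition zclosure M : set (proj_space R n) := smallest zclosed M.

Definition irreducible_closed Z : Prop :=
  [/\ zclosed Z, Z !=set0 &
      forall A B, zclosed A -> zclosed B -> Z = A `|` B -> Z = A \/ Z = B].

(* Topological (Krull) dimension, for M Zariski closed: the closed subsets of
   M are then the closed subsets of the whole space contained in M.
   The empty set satisfies dim_le M d for every d, and dim_ge M d for none. *)
Definition dim_ge M (d : nat) : Prop :=
  exists Z : nat -> set (proj_space R n),
    (forall i, (i <= d)%N -> irreducible_closed (Z i) /\ Z i `<=` M) /\
    (forall i, (i < d)%N -> Z i `<` Z i.+1).

Definition dim_le M (d : nat) : Prop := ~ dim_ge M d.+1.

Definition dim_eq M (d : nat) : Prop := dim_ge M d /\ dim_le M d.

Definition irr_component M : set (set (proj_space R n)) :=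
  [set Z | [/\ irreducible_closed Z, Z `<=` M &
    forall Z', irreducible_closed Z' -> Z' `<=` M -> Z `<=` Z' -> Z' = Z]].

(* Closed and of pure dimension 2; reducedness is automatic for zero loci. *)
Definition surface M : Prop :=
  zclosed M /\ (forall Z, irr_component M Z -> dim_eq Z 2).

Definition lin_subspace (U : {vspace 'rV[R[i]]_n.+1}) : set (proj_space R n) :=
  [set p | (val p <= U)%VS].

Definition is_linear M : Prop := exists U, M = lin_subspace U.

Definition lin_span M : set (proj_space R n) := smallest is_linear M.

(* A projective plane is the projectivization of a 3-dimensional space. *)
Definition is_plane M : Prop := exists2 U, \dim U = 3%N & M = lin_subspace U.

(* For a = b this would be the point a; [join] only uses it for a <> b. *)
Definition line (a b : proj_space R n) : set (proj_space R n) :=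
  lin_span [set a; b].

(* [A; B]; join A A is Sec(A). *)
Definition join A B : set (proj_space R n) :=
  zclosure [set p | exists a b, [/\ A a, B b, a <> b & line a b p]].

Definition Sec M : set (proj_space R n) :=
  \bigcup_(A in irr_component M) \bigcup_(B in irr_component M) join A B.

(* W lists the irreducible components of M without repetition. *)
Definition components_are M (r : nat) (W : 'I_r -> set (proj_space R n)) :
    Prop :=
  [/\ injective W, range W = irr_component M & M = \bigcup_i W i].

Definition planes_pairwise_meeting (r : nat)
    (W : 'I_r -> set (proj_space R n)) : Prop :=
  (forall i, is_plane (W i)) /\ (forall i j, (W i `&` W j) !=set0).

(* Indices are shifted by one: for components V_1, ..., V_r, the first t are
   the W i with i < t, and V_(t+1), ..., V_r are the W i with t <= i. *)
Definition condition_i (r t : nat) (W : 'I_r -> set (proj_space R n)) : Prop :=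
  (forall i : 'I_r, (i < t)%N -> dim_eq (lin_span (W i)) 3) /\
  (forall i : 'I_r, (t <= i)%N -> is_plane (W i)).

Definition condition_ii (r t : nat) (W : 'I_r -> set (proj_space R n)) : Prop :=
  [/\ forall i j : 'I_r, (i < t)%N -> (j < t)%N ->
        dim_ge (lin_span (W i) `&` lin_span (W j)) 2,
      forall i j : 'I_r, (i < t)%N -> (t <= j)%N ->
        dim_ge (lin_span (W i) `&` W j) 1 &
      forall i j : 'I_r, (t <= i)%N -> (t <= j)%N ->
        (W i `&` W j) !=set0].

End Zariski.

(* Main.v *)
(* Both directions reduce to linear algebra once one knows that P(U) has Krull
   dimension dim U - 1.  If every <V_i> = P(F_i) has dimension at most 3 and
   every <V_i u V_j> has dimension at most 4, then
   dim (F_i n F_j) >= dim F_i + dim F_j - 5, which is condition ii), and a V_i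
   spanning a plane is that plane because dim V_i = 2.  Conversely condition ii)
   says that dim (F_i + F_j) <= 5, and Sec V is covered by the P(F_i + F_j).

   The Krull dimension of P(U) is bounded by comparing Hilbert functions: along
   a strict chain Z_0 < ... < Z_d of irreducible closed sets, Z_d carries at
   least C(k + d, d) linearly independent forms of degree k e, for a fixed e and
   all k, whereas on P(U) there are only C(k e + dim U - 1, dim U - 1) of them. *)
Require Import Defs.
From mathcomp Require Import all_boot all_order all_algebra all_fingroup.
From mathcomp Require Import boolp classical_sets reals.
From mathcomp.real_closed Require Import complex.
From mathcomp Require Import mpoly.

Set Implicit Arguments.
Unset Strict Implicit.
Unset Printing Implicit Defensive.

Import GRing.Theory.
Local Open Scope ring_scope.
Local Open Scope classical_set_scope.

(** * Binomial estimates and evaluation of homogeneous polynomials *)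

Lemma leq_bin_dilate (e k m : nat) : (0 < e)%N ->
  ('C(k * e + m, m) <= e ^ m * 'C(k + m, m))%N.
Proof.
move=> e_gt0; elim: m => [|m IHm]; first by rewrite !bin0.
(* After multiplication by [m.+1] each binomial splits off one factor, and [k * e + m.+1] is at most
   [e * (k + m.+1)]. *)
rewrite -(leq_pmul2l (ltn0Sn m)) mulnCA -!mul_bin_diag !addnS /= expnS.
rewrite mulnACA leq_mul // -!addnS mulnDr mulnC leq_add2l leq_pmull //.
Qed.

(** In [k], the left side grows with degree [m] and the right side with degree [m.+1]. This gap is
    what rules out chains that are too long. *)
Lemma bin_dilate_lt (e m : nat) : (0 < e)%N ->
  exists k, ('C(k * e + m, m) < 'C(k + m.+1, m.+1))%N.
Proof.
(* The quotient of C(k+m+1, m+1) by C(k+m, m) is (k+m+1)/(m+1), which exceeds e^m for this [k]. *)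
move=> e_gt0; exists (m.+1 * e ^ m)%N; set k := (m.+1 * _)%N.
apply: leq_ltn_trans (leq_bin_dilate k m e_gt0) _.
rewrite -(ltn_pmul2l (ltn0Sn m)) -mul_bin_diag addnS /= mulnA.
by rewrite ltn_pmul2r ?bin_gt0 ?leq_addl // -addnS -/k -addn1 leq_add2l.
Qed.

Lemma comp_mpoly_dhomog (K : comNzRingType) (m n d : nat) (p : {mpoly K[n]})
    (lq : n.-tuple {mpoly K[m]}) :
  (forall i, tnth lq i \is 1.-homog) -> p \is d.-homog -> p \mPo lq \is d.-homog.
Proof.
move=> lq1 /dhomogP hp; have {}hp : {in msupp p, forall a, mdeg a = d} := hp.
rewrite comp_mpolyE big_seq.
apply: rpred_sum => a /hp <-; apply: dhomogZ; rewrite mdegE.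
apply: (big_rec2 (fun (q : {mpoly K[m]}) e => q \is e.-homog)) => [|i e q _ hq].
  exact: dhomog1.
by apply: dhomogM => //; rewrite -[X in X.-homog]mul1n; apply: dhomogMn.
Qed.

Lemma meval_dhomogZ (K : comNzRingType) (n d : nat) (p : {mpoly K[n]})
    (c : K) (v : 'I_n -> K) :
  p \is d.-homog -> p.@[fun i => c * v i] = c ^+ d * p.@[v].
Proof.
move=> /dhomogP hp; have {}hp : {in msupp p, forall a, mdeg a = d} := hp.
rewrite !mevalE big_distrr /= big_seq [RHS]big_seq.
apply: eq_bigr => a /hp <-; rewrite mulrCA; congr (_ * _).
rewrite mdegE -prodrXr -big_split /=.
by apply: eq_bigr => i _; rewrite exprMn.
Qed.

Lemma horner_mmap_polyC (K : comNzRingType) (n : nat) (p : {mpoly K[n]})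
    (h : 'I_n -> {poly K}) (t : K) :
  (mmap polyC h p).[t] = p.@[fun i => (h i).[t]].
Proof.
rewrite mevalE /mmap horner_sum; apply: eq_bigr => a _.
rewrite hornerM hornerC /mmap1 horner_prod; congr (_ * _).
by apply: eq_bigr => i _; rewrite horner_exp.
Qed.

(** * Points, vanishing of forms, and irreducible closed sets *)

Section ProjectiveSpace.
Variables (R : realType) (n : nat).
Local Notation K := R[i].
Local Notation P := (proj_space R n).
Implicit Types (p q : P) (A B M Z : set P) (U T : {vspace 'rV[K]_n.+1}).
Implicit Types (f g h : {mpoly K[n.+1]}) (u v w : 'rV[K]_n.+1).

Definition homogeneous f := exists d : nat, f \is d.-homog.

Definition vanishes_on f Z := forall p, Z p -> vanishes f p.

Lemma homogeneousM f g : homogeneous f -> homogeneous g -> homogeneous (f * g).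
Proof. by move=> [d fd] [e ge]; exists (d + e)%N; apply: dhomogM. Qed.

Lemma dim_line v : v != 0 -> \dim <[v]> == 1%N.
Proof. by rewrite dim_vline => ->. Qed.

Definition point v (v0 : v != 0) : P := exist _ <[v]>%VS (dim_line v0).

Lemma pointP p : exists v (v0 : v != 0), p = point v0.
Proof.
case: p => U dU; exists (vpick U).
have v0 : vpick U != 0 by rewrite vpick0 -dimv_eq0 (eqP dU).
exists v0; apply: eq_exist => /=; apply/esym/eqP.
by rewrite eqEdim (eqP dU) dim_vline v0 -memvE memv_pick.
Qed.

Lemma vanishes_point f v (v0 : v != 0) : homogeneous f ->
  vanishes f (point v0) <-> f.@[fun i => v 0 i] = 0.
Proof.
move=> [d fd]; split=> [|fv w /vlineP[c ->]]; first by apply; exact: memv_line.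
have -> : f.@[fun i => (c *: v) 0 i] = f.@[fun i => c * v 0 i].
  by apply: meval_eq => i; rewrite mxE.
by rewrite (meval_dhomogZ c _ fd) fv mulr0.
Qed.

Lemma vanishesM f g p : homogeneous f -> homogeneous g ->
  vanishes (f * g) p <-> vanishes f p \/ vanishes g p.
Proof.
move=> hf hg; have [v [v0 ->]] := pointP p.
rewrite !vanishes_point //; last exact: homogeneousM.
rewrite mevalM; split=> [/eqP|[->|->]]; rewrite ?mul0r ?mulr0 //.
by rewrite mulf_eq0 => /orP[]/eqP; [left|right].
Qed.

Lemma vanishes_exp f e p : (0 < e)%N -> homogeneous f ->
  vanishes (f ^+ e) p <-> vanishes f p.
Proof.
move=> e0 hf; have [v [v0 ->]] := pointP p; have [d fd] := hf.
have hfe : homogeneous (f ^+ e) by exists (d * e)%N; apply: dhomogMn.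
rewrite !vanishes_point // rmorphXn /=; split=> [/eqP|->].
  by rewrite expf_eq0 e0 => /eqP.
by rewrite expr0n gtn_eqF.
Qed.

Lemma zclosed_setI_vanishes Z f : zclosed Z -> homogeneous f ->
  zclosed (Z `&` [set p | vanishes f p]).
Proof.
move=> [S [hS ->]] hf; exists (S `|` [set f]); split=> [g [/hS|->]//|].
apply/seteqP; split=> p /= => [[Sp fp] g [/Sp|->]//|Sp].
by split=> [g Sg|]; apply: Sp; [left|right].
Qed.

Lemma zclosed_separate Z p : zclosed Z -> ~ Z p ->
  exists f, [/\ homogeneous f, vanishes_on f Z & ~ vanishes f p].
Proof.
move=> [S [hS ->]] /existsNP[f /not_implyP[Sf fp]].
by exists f; split=> // [|q]; [exact: hS|apply].
Qed.

(** The ideal of an irreducible set is prime: [Z] is the union of the closed subsets cut out on it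
    by [f] and by [g]. *)
Lemma irreducible_vanishesM Z f g : irreducible_closed Z ->
  homogeneous f -> homogeneous g ->
  vanishes_on (f * g) Z -> vanishes_on f Z \/ vanishes_on g Z.
Proof.
move=> [cZ _ irrZ] hf hg fg0.
have [|||/seteqP[Zf _]|/seteqP[Zf _]] :=
  irrZ (Z `&` [set p | vanishes f p]) (Z `&` [set p | vanishes g p]).
- exact: zclosed_setI_vanishes.
- exact: zclosed_setI_vanishes.
- apply/seteqP; split=> [p Zp|p [[]|[]]//].
  by have /(vanishesM _ hf hg)[] := fg0 p Zp; [left|right].
- by left=> p /Zf[].
- by right=> p /Zf[].
Qed.

Lemma irreducible_sub_bigcup (I : finType) (F : I -> set P) Z :
  irreducible_closed Z -> (forall i, zclosed (F i)) ->
  Z `<=` \bigcup_i F i -> exists i, Z `<=` F i.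
Proof.
move=> irrZ cF ZF.
(* Invariant for an induction on the list of indices: [g] is a product of forms, one for each
   discarded [F i], vanishing on that [F i] but not on [Z]. Once the list is empty, [g] would vanish
   on [Z]. *)
have : exists g, [/\ homogeneous g, ~ vanishes_on g Z & forall p, Z p ->
    vanishes g p \/ exists2 i, i \in enum I & F i p].
  have h1 : homogeneous 1 by exists 0%N; apply: dhomog1.
  exists 1; split=> // [|p /ZF[i _ Fip]]; last by right; exists i; rewrite ?mem_enum.
  have [_ [p Zp] _] := irrZ => /(_ p Zp); have [v [v0 ->]] := pointP p.
  by rewrite vanishes_point // meval1; move/eqP; rewrite oner_eq0.
elim: (enum I) => [|i s IHs] [g [hg gZ gF]].
  by case: gZ => p /gF[|[]].
have [Zi|] := pselect (Z `<=` F i); first by exists i.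
move=> /existsNP[q /not_implyP[Zq nFq]].
have [f [hf fi fq]] := zclosed_separate (cF i) nFq.
apply: IHs; exists (g * f); split; first exact: homogeneousM.
  by move=> /(irreducible_vanishesM irrZ hg hf)[//|/(_ q Zq)].
move=> p /gF[gp|[j /predU1P[->|js] Fjp]].
- by left; apply/vanishesM => //; left.
- by left; apply/vanishesM => //; right; apply: fi.
- by right; exists j.
Qed.

(** * Linear subspaces: closedness, irreducibility, spans *)

Lemma lin_subspace_point U v (v0 : v != 0) :
  lin_subspace U (point v0) = (v \in U).
Proof. by rewrite memvE. Qed.

Lemma lin_subspaceP U T : lin_subspace U `<=` lin_subspace T <-> (U <= T)%VS.
Proof.
split=> [UT|UT p /= pU]; last exact: subv_trans UT.
apply/subvP => v vU; have [->|v0] := eqVneq v 0; first exact: mem0v.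
by have := UT (point v0); rewrite !lin_subspace_point; apply.
Qed.

Lemma lin_subspace_inj : injective (@lin_subspace R n).
Proof.
move=> U T UT; apply/eqP.
by rewrite eqEsubv; apply/andP; split; apply/lin_subspaceP; rewrite UT.
Qed.

Lemma lin_subspaceI U T :
  lin_subspace U `&` lin_subspace T = lin_subspace (U :&: T)%VS.
Proof.
by apply/seteqP; rewrite /lin_subspace; split=> p /=; rewrite subv_cap;
  [case=> -> ->|case/andP].
Qed.

Lemma linear_form_meval (a : 'I_n.+1 -> K) v :
  (\sum_i a i *: 'X_i : {mpoly K[n.+1]}).@[fun i => v 0 i] =
  \sum_i a i * v 0 i.
Proof.
rewrite raddf_sum /=; apply: eq_bigr => i _.
by rewrite mevalZ mevalXU.
Qed.

Lemma linear_form_dhomog m (a : 'I_m -> K) :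
  (\sum_i a i *: 'X_i : {mpoly K[m]}) \is 1.-homog.
Proof. by apply: rpred_sum => i _; rewrite dhomogZ // dhomogX /= mdeg1. Qed.

Lemma separating_form U v : v \notin U -> exists f, [/\ homogeneous f,
  f.@[fun i => v 0 i] != 0 & forall u, u \in U -> f.@[fun i => u 0 i] = 0].
Proof.
(* [pi] is linear with kernel [U], so some coordinate of it is a linear form that vanishes on [U]
   but not at [v]. *)
move=> vU; pose pi u : 'rV[K]_n.+1 := u - projv U u.
have pi_lin u j : pi u 0 j = \sum_i (pi (delta_mx 0 i)) 0 j * u 0 i.
  have -> : pi u = \sum_i u 0 i *: pi (delta_mx 0 i).
    rewrite /pi {1 2}(row_sum_delta u) linear_sum -sumrB.
    by apply: eq_bigr => i _; rewrite linearZ scalerBr.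
  by rewrite summxE; apply: eq_bigr => i _; rewrite mxE mulrC.
have : pi v != 0.
  by apply: contraNneq vU => /eqP; rewrite subr_eq0 => /eqP ->; apply: memv_proj.
case/rV0Pn => j pivj; exists (\sum_i (pi (delta_mx 0 i)) 0 j *: 'X_i).
split; first by exists 1%N; apply: linear_form_dhomog.
  by rewrite linear_form_meval -pi_lin.
by move=> u uU; rewrite linear_form_meval -pi_lin /pi projv_id // subrr mxE.
Qed.

Lemma zclosed_lin_subspace U : zclosed (lin_subspace U).
Proof.
exists [set f | homogeneous f /\ vanishes_on f (lin_subspace U)].
split=> [f []//|]; apply/seteqP; split=> [p Up f [_]|p]; first exact.
have [v [v0 ->]] := pointP p => vf; rewrite lin_subspace_point.
apply: contrapT => /negP/separating_form[f [hf fv fU]].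
case/eqP: fv; apply/(vanishes_point v0 hf)/vf; split=> // q.
have [w [w0 ->]] := pointP q ; rewrite lin_subspace_point => wU.
by apply/vanishes_point => //; apply: fU.
Qed.

(** Take a point of P(U) where [f] is nonzero and one where [g] is nonzero. On the line through them
    both restrict to nonzero polynomials in one variable, and over an algebraically closed field
    these have a common nonroot. *)
Lemma vanishes_on_lin_subspaceM U f g : homogeneous f -> homogeneous g ->
  vanishes_on (f * g) (lin_subspace U) ->
  vanishes_on f (lin_subspace U) \/ vanishes_on g (lin_subspace U).
Proof.
move=> hf hg fgU; apply: contrapT => /not_orP[].
move=> /existsNP[p /not_implyP[]]; have [u [u0 ->]] := pointP p.
rewrite lin_subspace_point vanishes_point // => uU fu.
move=> /existsNP[q /not_implyP[]]; have [v [v0 ->]] := pointP q.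
rewrite lin_subspace_point vanishes_point // => vU gv.
pose l i : {poly K} := (u 0 i)%:P + (v 0 i - u 0 i) *: 'X.
have lE t i : (l i).[t] = (u + t *: (v - u)) 0 i.
  by rewrite /l hornerD hornerC hornerZ hornerX !mxE mulrC.
have l_at h t : (mmap polyC l h).[t] = h.@[fun i => (u + t *: (v - u)) 0 i].
  by rewrite horner_mmap_polyC; apply: meval_eq => i; rewrite lE.
have l_at0 h : (mmap polyC l h).[0] = h.@[fun i => u 0 i].
  by rewrite l_at scale0r addr0.
have l_at1 h : (mmap polyC l h).[1] = h.@[fun i => v 0 i].
  by rewrite l_at scale1r addrC subrK.
have /rV0Pn[i ui] := u0.
(* The third factor ensures that the vector found at the nonroot is nonzero, hence represents a
   point. *)
have : mmap polyC l f * mmap polyC l g * l i != 0.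
  rewrite !mulf_neq0 //.
  - by apply/eqP => lf; apply: fu; rewrite -l_at0 lf horner0.
  - by apply/eqP => lg; apply: gv; rewrite -l_at1 lg horner0.
  - apply: contraNneq ui => li.
    by rewrite -[u](addr0) -[0 in X in _ + X](scale0r (v - u)) -lE li horner0.
move=> /closed_nonrootP[t].
rewrite /root !hornerM !mulf_eq0 !negb_or !l_at lE => /andP[/andP[ft gt] wi].
set w := u + _ in ft gt wi.
have w0 : w != 0 by apply: contraNneq wi => ->; rewrite mxE.
have wU : w \in U by rewrite rpredD // rpredZ // rpredB.
have := fgU (point w0); rewrite lin_subspace_point => /(_ wU).
by case/(vanishesM _ hf hg); rewrite vanishes_point // => /eqP; apply/negP.
Qed.

Lemma lin_subspace_irreducible U :
  (0 < \dim U)%N -> irreducible_closed (lin_subspace U).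
Proof.
move=> U_gt0; split; first exact: zclosed_lin_subspace.
  have v0 : vpick U != 0 by rewrite vpick0 -dimv_eq0 -lt0n.
  by exists (point v0); rewrite lin_subspace_point memv_pick.
move=> A B cA cB UAB; apply: contrapT => /not_orP[nUA nUB].
have notin C : zclosed C -> C `<=` lin_subspace U -> lin_subspace U <> C ->
    exists f, [/\ homogeneous f, vanishes_on f C &
                  ~ vanishes_on f (lin_subspace U)].
  move=> cC CU nUC; have /existsNP[p /not_implyP[Up nCp]] : ~ lin_subspace U `<=` C.
    by move=> UC; apply: nUC; apply/seteqP.
  have [f [hf fC fp]] := zclosed_separate cC nCp.
  by exists f; split=> // /(_ p Up).
have [|f [hf fA fU]] := notin A cA _ nUA; first by rewrite UAB; left.
have [|g [hg gB gU]] := notin B cB _ nUB; first by rewrite UAB; right.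
have [] // := @vanishes_on_lin_subspaceM U f g hf hg.
by rewrite UAB => p [/fA|/gB] ?; apply/vanishesM => //; [left|right].
Qed.

(** A [U] of minimal dimension with [M] inside P(U) is the least one: intersecting it with any other
    candidate cannot lower its dimension. *)
Lemma lin_spanE M : exists U, lin_span M = lin_subspace U.
Proof.
pose Q d := `[< exists2 U, \dim U = d & M `<=` lin_subspace U >].
have exQ : exists d, Q d.
  by exists (\dim {:'rV[K]_n.+1}); apply/asboolP; exists fullv => // p _; apply: subvf.
case: (ex_minnP exQ) => d /asboolP[U dU MU] minU.
exists U; apply/seteqP; split; first by apply: smallest_sub => //; exists U.
move=> p Up _ [[T ->] MT]; move: p Up; apply/lin_subspaceP.
have MUT : M `<=` lin_subspace (U :&: T)%VS.
  by rewrite -lin_subspaceI => p Mp; split; [apply: MU|apply: MT].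
have : (U :&: T == U)%VS.
  by rewrite eqEdim capvSl dU minU //; apply/asboolP; exists (U :&: T)%VS.
by move=> /eqP <-; apply: capvSr.
Qed.

Lemma lin_span_lin_subspace U : lin_span (lin_subspace U) = lin_subspace U.
Proof. by apply: smallest_id; exists U. Qed.

(** * Forms independent modulo the ideal of a set, and the Krull dimension of P(U) *)

Definition independent_on Z (I : finType) (g : I -> {mpoly K[n.+1]}) :=
  forall c : I -> K, vanishes_on (\sum_i c i *: g i) Z -> forall i, c i = 0.

Lemma homogeneous_sum d (I : finType) (g : I -> {mpoly K[n.+1]}) (c : I -> K) :
  (forall i, g i \is d.-homog) -> homogeneous (\sum_i c i *: g i).
Proof. by move=> hg; exists d; apply: rpred_sum => i _; apply: dhomogZ. Qed.

Lemma independent_on_unit Z f : ~ vanishes_on f Z ->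
  independent_on Z (fun _ : unit => f).
Proof.
move=> fZ c; rewrite (big_pred1 tt) => [cf0 []|[]//].
apply: contrapT => /eqP c0; apply: fZ => p Zp v vp.
by have /eqP := cf0 p Zp v vp; rewrite mevalZ mulf_eq0 (negPf c0) => /eqP.
Qed.

(** Restricting a relation to [Z] kills the multiples of [h], so the coefficients of [g] are zero.
    What remains is [h] times a combination of the [g'], and [h] cancels because the ideal of [Z']
    is prime. *)
Lemma independent_on_sum Z Z' h d (I I' : finType)
    (g : I -> {mpoly K[n.+1]}) (g' : I' -> {mpoly K[n.+1]}) :
  Z `<=` Z' -> irreducible_closed Z' ->
  homogeneous h -> vanishes_on h Z -> ~ vanishes_on h Z' ->
  (forall i, g' i \is d.-homog) ->
  independent_on Z g -> independent_on Z' g' ->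
  independent_on Z' (fun x : I + I' =>
    match x with inl i => g i | inr i => h * g' i end).
Proof.
move=> ZZ' irrZ' hh hZ hZ' hg' ig ig' c.
rewrite big_sumType /=.
have -> : \sum_i c (inr i) *: (h * g' i) = h * \sum_i c (inr i) *: g' i.
  by rewrite mulr_sumr; apply: eq_bigr => i _; rewrite scalerAr.
set G := \sum_i c (inl i) *: g i; set G' := \sum_i c (inr i) *: g' i => GG'.
have cl : forall i, c (inl i) = 0.
  apply: (ig (c \o inl)) => p Zp v vp.
  by have := GG' p (ZZ' p Zp) v vp; rewrite mevalD mevalM (hZ p Zp v vp) mul0r addr0.
have G0 : G = 0 by apply: big1 => i _; rewrite cl scale0r.
rewrite G0 add0r in GG'.
have hG' : homogeneous G' by exact: homogeneous_sum hg'.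
have [//|G'0] := irreducible_vanishesM irrZ' hh hG' GG'.
by case=> [//|i]; apply: (ig' (c \o inr)).
Qed.

(* A lower bound on the Hilbert function: it grows at least like a polynomial
   of degree d.  If h vanishes on Z_(d-1) but not on Z_d, multiplication by h
   embeds S/I(Z_d) into the kernel of S/I(Z_d) -> S/I(Z_(d-1)), which yields
   Pascal's recurrence. *)
Lemma chain_independent_forms (Z : nat -> set P) d :
  (forall i, (i <= d)%N -> irreducible_closed (Z i)) ->
  (forall i, (i < d)%N -> Z i `<` Z i.+1) ->
  exists2 e, (0 < e)%N & forall k, exists (I : finType) (g : I -> {mpoly K[n.+1]}),
    [/\ ('C(k + d, d) <= #|I|)%N, forall i, g i \is (k * e).-homog &
        independent_on (Z d) g].
Proof.
elim: d => [|d IHd] irrZ ltZ.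
  have [_ [p Zp] _] := irrZ 0%N (leqnn _); have [v [v0 pE]] := pointP p.
  have /rV0Pn[j vj] := v0.
  exists 1%N => // k; exists unit, (fun=> 'X_j ^+ k).
  have Xk : 'X_j ^+ k \is [in K[n.+1], (k * 1).-homog].
    by rewrite mulnC; apply: dhomogMn; rewrite dhomogX /= mdeg1.
  split=> //; first by rewrite bin0 card_unit.
  apply: independent_on_unit => /(_ p Zp).
  rewrite pE vanishes_point; last by exists (k * 1)%N.
  by rewrite rmorphXn /= mevalXU => /eqP; rewrite expf_eq0 (negPf vj) andbF.
have [||e e0 IH] := IHd; [by move=> i /leqW/irrZ|by move=> i /leqW/ltZ|].
have [ZZ' Z'Z] := ltZ d (leqnn _).
have irrZ' := irrZ d.+1 (leqnn _).
have [cZ Zn0 _] := irrZ d (leqnSn _).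
have /existsNP[q /not_implyP[Z'q Zq]] := Z'Z.
have [f [[a fa] fZ fq]] := zclosed_separate cZ Zq.
have hf : homogeneous f by exists a.
(* A form of degree 0 takes at every point its value at the zero vector. *)
have a0 : (0 < a)%N.
  rewrite lt0n; apply/eqP => a0; have [p Zp] := Zn0; apply: fq => v _.
  have := fZ p Zp 0 (mem0v _); rewrite {}a0 in fa.
  move=> <-; rewrite -[LHS]mul1r -[1](expr0 0) -(meval_dhomogZ _ _ fa).
  by apply: meval_eq => i; rewrite mul0r mxE.
(* Replacing [f], of degree [a], by its power [f ^+ e] makes the degrees match: multiplication by
   [h] goes from degree k(ae) to (k+1)(ae), and the latter is also the degree of the forms given on
   [Z d] by the induction hypothesis at (k+1)a. *)
exists (a * e)%N; first by rewrite muln_gt0 a0.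
pose h := f ^+ e.
have ha : h \is (a * e).-homog by apply: dhomogMn.
have hh : homogeneous h by exists (a * e)%N.
have hZ : vanishes_on h (Z d) by move=> p Zp; apply/vanishes_exp => //; apply: fZ.
have hZ' : ~ vanishes_on h (Z d.+1).
  by move=> /(_ q Z'q) /(vanishes_exp _ e0 hf).
elim=> [|k [I' [g' [cI' hg' ig']]]].
  exists unit, (fun=> 1); split=> [|_|]; rewrite ?add0n ?binn ?card_unit ?dhomog1 //.
  apply: independent_on_unit => h1; apply: hZ' => p Zp v vp.
  by have /eqP := h1 p Zp v vp; rewrite meval1 oner_eq0.
have [I [g [cI hg ig]]] := IH (k.+1 * a)%N.
exists (I + I')%type, (fun x => match x with inl i => g i | inr i => h * g' i end).
split.
(* Pascal's rule; the family on [Z d] has at least C((k+1)a+d, d) members, which is at least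
   C(k+1+d, d) since [a] is positive. *)
- rewrite card_sum addnS binS addnC leq_add //; last by rewrite addSnnS.
  by apply: leq_trans cI; rewrite leq_bin2l // leq_add2r leq_pmulr.
- case=> i; first by rewrite mulnA.
  by rewrite mulSn; apply: dhomogM.
- by apply: (independent_on_sum (d := (k * (a * e))%N) (Z := Z d)) => // p /ZZ'.
Qed.

Lemma dim_ge_lin_subspace_lt U d : dim_ge (lin_subspace U) d -> (d < \dim U)%N.
Proof.
move=> [Z [irrZ ltZ]].
have U_gt0 : (0 < \dim U)%N.
  rewrite lt0n dimv_eq0; apply/eqP => U0.
  have [[_ [p Zp] _] ZU] := irrZ 0%N isT.
  have := ZU p Zp; have [v [v0 ->]] := pointP p.
  by rewrite lin_subspace_point U0 memv0 (negPf v0).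
rewrite ltnNge; apply/negP => Ud.
case dimU : (\dim U) U_gt0 Ud => [//|m] _ md.
have [|//|e e0 indep] := @chain_independent_forms Z d; first by move=> i /irrZ[].
have [k] := bin_dilate_lt m e0.
have [I [g [cI hg ig]]] := indep k; apply/negP; rewrite -leqNgt.
have [B basisB] : exists B : m.+1.-tuple 'rV[K]_n.+1, basis_of U B.
  by rewrite -dimU; exists (vbasis U); apply: vbasisP.
(* [lq] parametrizes [U] by coordinates in the basis [B]. Substituting it turns forms in [n.+1]
   variables into forms in [m.+1] variables; independence survives because [Z d] lies in P(U), so
   every vector over it is a value of [lq]. *)
pose lq := [tuple \sum_(j < m.+1) B`_j 0 i *: 'X_j : {mpoly K[m.+1]} | i < n.+1].
have lq1 i : tnth lq i \is 1.-homog by rewrite tnth_mktuple linear_form_dhomog.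
pose G i : dhomog m.+1 K (k * e) := DHomog (comp_mpoly_dhomog lq1 (hg i)).
pose X := [tuple G (enum_val i) | i < #|I|].
have freeX : free X.
  apply/freeP => c cX i.
  have cg : (\sum_x c (enum_rank x) *: g x) \mPo lq = 0.
    rewrite -[RHS](congr1 (@mpoly_of_dhomog m.+1 K (k * e)) cX) !raddf_sum /=.
    rewrite (reindex (@enum_val I I)) /=; last exact: onW_bij (enum_val_bij I).
    apply: eq_bigr => j _.
    by rewrite enum_valK comp_mpolyZ nth_mktuple.
  suff : forall x, c (enum_rank x) = 0 by move/(_ (enum_val i)); rewrite enum_valK.
  apply: (ig (c \o enum_rank)) => p Zp v vp.
  have vU : v \in U by have [_ /(_ p Zp)/subvP] := irrZ d (leqnn d); apply.
  have lqv i' : v 0 i' = (tnth lq i').@[fun j => coord B j v].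
    rewrite tnth_mktuple raddf_sum /= {1}(coord_basis basisB vU) summxE.
    by apply: eq_bigr => j _; rewrite mxE mevalZ mevalXU mulrC.
  by rewrite (meval_eq _ lqv) -comp_mpoly_meval cg meval0.
(* The number of free forms is at most the dimension C(ke+m, m) of the space of forms of degree
   [k * e] in [m.+1] variables. *)
have := dimvS (subvf <<X>>%VS).
have /eqP -> := freeX; rewrite size_tuple dimvf => leI.
(* With the lower index fixed to [k] the coefficient is monotone in [x], which allows passing from
   [m.+1] to [d]. *)
have binE x : 'C(k + x, x) = 'C(k + x, k).
  by rewrite -[LHS]bin_sub ?leq_addl // addnK.
apply: leq_trans (_ : _ <= #|I|)%N _.
  by apply: leq_trans cI; rewrite !binE leq_bin2l // leq_add2l.
apply: leq_trans leI _; rewrite -[leqRHS]bin_sub ?leq_addl // addnK.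
by [].
Qed.

Lemma dim_ge_lin_subspace U d : dim_ge (lin_subspace U) d <-> (d < \dim U)%N.
Proof.
split=> [/dim_ge_lin_subspace_lt//|dU].
(* The flag of a basis gives the chain; [i.+1] vectors span a projective subspace of dimension
   [i]. *)
pose F i := <<take i.+1 (vbasis U)>>%VS.
have dimF i : (i <= d)%N -> \dim (F i) = i.+1.
  move=> id; have iU : (i.+1 <= size (vbasis U))%N.
    by rewrite size_tuple; apply: leq_ltn_trans dU.
  rewrite /F; have /eqP -> : free (take i.+1 (vbasis U)).
    have := basis_free (vbasisP U); rewrite -{1}(cat_take_drop i.+1 (vbasis U)).
    exact: catl_free.
  by rewrite size_takel.
exists (fun i => lin_subspace (F i)); split=> i id /=.
  split; first by apply: lin_subspace_irreducible; rewrite dimF.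
  apply/lin_subspaceP; apply/span_subvP => v /mem_take; exact: vbasis_mem.
split; last by move=> /lin_subspaceP/dimvS; rewrite !dimF ?ltnn // ltnW.
apply/lin_subspaceP; apply: sub_span => v.
by rewrite -(take_takel (vbasis U) (leqnSn i.+1)) => /mem_take.
Qed.

Lemma dim_le_lin_subspace U d : dim_le (lin_subspace U) d <-> (\dim U <= d.+1)%N.
Proof.
rewrite /dim_le leqNgt; split=> [nU|/negP nU /dim_ge_lin_subspace//].
by apply/negP => /dim_ge_lin_subspace.
Qed.

(** * Dimension bounds for subsets and for secant varieties *)

Lemma dim_geS A B d : A `<=` B -> dim_ge A d -> dim_ge B d.
Proof.
move=> AB [Z [irrZ ltZ]]; exists Z; split=> // i /irrZ[? ZA]; split=> //.
exact: subset_trans AB.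
Qed.

(** If [A] were a proper subset, P(U) could be appended to a chain in [A], giving a longer chain
    than [\dim U] allows. This identifies a component spanning a plane with that plane. *)
Lemma lin_subspace_dim_ge_eq A U d : A `<=` lin_subspace U ->
  dim_ge A d -> \dim U = d.+1 -> A = lin_subspace U.
Proof.
move=> AU [Z [irrZ ltZ]] dU; apply/seteqP; split=> //; apply: contrapT => UA.
suff /dim_ge_lin_subspace : dim_ge (lin_subspace U) d.+1 by rewrite dU ltnn.
exists (fun i => if (i <= d)%N then Z i else lin_subspace U); split=> i.
  move=> _; case: leqP => [/irrZ[? ZA]|_].
    by split=> //; apply: subset_trans AU.
  by split=> //; apply: lin_subspace_irreducible; rewrite dU.
move=> id1; have /predU1P[->|id] : (i == d) || (i < d)%N by rewrite -leq_eqVlt.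
  rewrite leqnn ltnn; have [_ ZA] := irrZ d (leqnn d).
  by split; [exact: subset_trans AU|move=> UZ; apply: UA; apply: subset_trans ZA].
by rewrite (ltnW id) id; exact: ltZ.
Qed.

Lemma join_sub_lin_subspace A B U T : A `<=` lin_subspace U ->
  B `<=` lin_subspace T -> join A B `<=` lin_subspace (U + T)%VS.
Proof.
move=> AU BT; apply: smallest_sub; first exact: zclosed_lin_subspace.
move=> p [a [b [Aa Bb _ pab]]]; move: pab; apply: smallest_sub.
  by exists (U + T)%VS.
have sumU : (U <= U + T)%VS by exact: addvSl.
have sumT : (T <= U + T)%VS by exact: addvSr.
by move=> ? [->|->] /=; [apply: subv_trans sumU; apply: AU|
  apply: subv_trans sumT; apply: BT].
Qed.

Lemma Sec_sub (r : nat) (V : set P) (W : 'I_r -> set P)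
    (F : 'I_r -> {vspace 'rV[K]_n.+1}) : components_are V W ->
  (forall i, W i `<=` lin_subspace (F i)) ->
  Sec V `<=` \bigcup_ij lin_subspace (F ij.1 + F ij.2)%VS.
Proof.
move=> [_ WV _] WF p [A VA [B VB jp]].
move: VA VB; rewrite -WV => -[i _ Ai] [j _ Bj]; exists (i, j) => //=.
by apply: join_sub_lin_subspace jp; rewrite -?Ai -?Bj.
Qed.

(** The top member of a chain in [A] is irreducible, so it lies in a single P(F i), and the whole
    chain with it. *)
Lemma dim_le_bigcup_lin_subspace (I : finType)
    (F : I -> {vspace 'rV[K]_n.+1}) A d :
  A `<=` \bigcup_i lin_subspace (F i) ->
  (forall i, (\dim (F i) <= d.+1)%N) -> dim_le A d.
Proof.
move=> AF dF [Z [irrZ ltZ]]; have [irrZd ZdA] := irrZ d.+1 (leqnn _).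
have [||i ZF] := irreducible_sub_bigcup (F := fun i => lin_subspace (F i)) irrZd.
- by move=> i; exact: zclosed_lin_subspace.
- exact: subset_trans AF.
have /dim_ge_lin_subspace : dim_ge (lin_subspace (F i)) d.+1.
  exists Z; split=> // j jd; split; first by have [] := irrZ j jd.
  apply: subset_trans ZF.
  have Zmono : forall k, (j + k <= d.+1)%N -> Z j `<=` Z (j + k)%N.
    elim=> [_ p|k IHk]; first by rewrite addn0.
    rewrite addnS => jkd; apply: subset_trans (IHk (ltnW jkd)) _.
    by have [] := ltZ _ jkd.
  by have := Zmono (d.+1 - j)%N; rewrite subnKC //; apply.
by rewrite ltnNge dF.
Qed.

Lemma lin_subspaceI_nonempty U T :
  lin_subspace U `&` lin_subspace T !=set0 <-> (0 < \dim (U :&: T))%N.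
Proof.
rewrite lin_subspaceI; split=> [[p /dimvS]|]; first by case: p => L /= /eqP ->.
by case/lin_subspace_irreducible.
Qed.

End ProjectiveSpace.

(** * Reordering of the components and the two directions of the theorem *)

Lemma perm_separating (r : nat) (A : pred 'I_r) :
  exists s : 'S_r, forall i : 'I_r, (i < #|A|)%N = A (s i).
Proof.
(* The permutation sends [i] to the [i]-th entry of this list, where the members of [A] come
   first. *)
pose e := enum A ++ enum (predC A).
have size_e : size e == r by rewrite size_cat -!cardE cardC card_ord.
have uniq_e : uniq e.
  rewrite cat_uniq !enum_uniq andbT /=.
  by apply/hasPn => i; rewrite !mem_enum.
have inj_e : injective (tnth (Tuple size_e)) by apply/tuple_uniqP.
exists (perm inj_e) => i; rewrite permE (tnth_nth i) /= nth_cat -cardE.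
case: ltnP => iA; apply/esym.
  by have := mem_nth i (s := enum A) (n := i); rewrite -cardE mem_enum; apply.
have := mem_nth i (s := enum (predC A)) (n := (i - #|A|)%N).
rewrite mem_enum -cardE ltn_subLR // cardC card_ord => /(_ (ltn_ord i)).
exact: negPf.
Qed.

Theorem theorem5 (R : realType) (n : nat) :
  (forall (r : nat) (V : set (proj_space R n))
          (W : 'I_r -> set (proj_space R n)),
     (3 <= r)%N ->
     surface V ->
     components_are V W ->
     dim_le (Sec V) 4 ->
     dim_ge (lin_span V) 5 ->
     (forall i, dim_le (lin_span (W i)) 3) ->
     (forall i j, dim_le (lin_span (W i `|` W j)) 4) ->
     planes_pairwise_meeting W \/
     exists (s : 'S_r) (t : nat),
       [/\ (1 <= t <= r)%N,
           condition_i t (fun i => W (s i)) &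
           condition_ii t (fun i => W (s i))])
  /\
  (forall (r : nat) (V : set (proj_space R n))
          (W : 'I_r -> set (proj_space R n)),
     (3 <= r)%N ->
     surface V ->
     components_are V W ->
     dim_ge (lin_span V) 5 ->
     (forall i, dim_le (lin_span (W i)) 3) ->
     planes_pairwise_meeting W \/
     (exists t : nat,
        [/\ (1 <= t <= r)%N, condition_i t W & condition_ii t W]) ->
     dim_le (Sec V) 4).
Proof.
split=> r V W _ surfV compW; last first.
  (* The converse direction. *)
  move=> _ span3 cases.
  have [F FE] := choice (fun i => lin_spanE (W i)).
  have WF i : W i `<=` lin_subspace (F i) by rewrite -FE; apply: sub_gen_smallest.
  have F4 i : (\dim (F i) <= 4)%N by apply/dim_le_lin_subspace; rewrite -FE.
  (* Pairwise meeting planes are the case [t = 0] of conditions i) and ii), so one argument covers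
     both alternatives. *)
  have [t [[_ plane] [cond33 cond32 cond22]]] :
      exists t, condition_i t W /\ condition_ii t W.
    case: cases => [[plane meet]|[t [_ ? ?]]]; last by exists t.
    by exists 0%N; split; split.
  have planeF (i : 'I_r) : (t <= i)%N -> \dim (F i) = 3%N /\ W i = lin_subspace (F i).
    move=> /plane[U dU WU]; have := FE i.
    by rewrite WU lin_span_lin_subspace => /lin_subspace_inj <-.
  have mixed (i j : 'I_r) : (i < t)%N -> (t <= j)%N -> (1 < \dim (F i :&: F j))%N.
    move=> it tj; have [_ Wj] := planeF j tj.
    by apply/dim_ge_lin_subspace; rewrite -lin_subspaceI -FE -Wj; apply: cond32.
  apply: (dim_le_bigcup_lin_subspace (Sec_sub compW WF)) => -[i j] /=.
  (* By Grassmann's formula the bound 5 on the dimension of [F i + F j] requires intersections of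
     vector dimension at least 3, 2, 2 and 1 in the four cases, one more than the projective
     dimensions in condition ii). *)
  rewrite -(leq_add2r (\dim (F i :&: F j))) dimv_sum_cap.
  have [it|ti] := ltnP i t; have [jt|tj] := ltnP j t.
  - have : (2 < \dim (F i :&: F j))%N.
      by apply/dim_ge_lin_subspace; rewrite -lin_subspaceI -!FE; apply: cond33.
    by move=> cap; apply: leq_trans (leq_add (F4 i) (F4 j)) _; rewrite (leq_add2l 5 3).
  - have [dj _] := planeF j tj; rewrite dj.
    apply: leq_trans (leq_add (F4 i) (leqnn 3)) _.
    by rewrite (leq_add2l 5 2) mixed.
  - have [di _] := planeF i ti; rewrite di capvC.
    apply: leq_trans (leq_add (leqnn 3) (F4 j)) _.
    by rewrite (leq_add2l 5 2) mixed.
  - have [di Wi] := planeF i ti; have [dj Wj] := planeF j tj.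
    rewrite di dj (leq_add2l 5 1); apply/lin_subspaceI_nonempty.
    by rewrite -Wi -Wj; apply: cond22.
(* The direct implication: every [F i] has dimension 3 or 4, and dimension 3 means that [W i] is a
   plane. *)
move=> _ _ span3 span4.
have [F FE] := choice (fun i => lin_spanE (W i)).
have WF i : W i `<=` lin_subspace (F i) by rewrite -FE; apply: sub_gen_smallest.
have F4 i : (\dim (F i) <= 4)%N by apply/dim_le_lin_subspace; rewrite -FE.
have W2 i : dim_ge (W i) 2.
  have [_ WV _] := compW; have [_ /(_ (W i))[]//] := surfV.
  by rewrite -WV; exists i.
have F3 i : (2 < \dim (F i))%N.
  by apply/dim_ge_lin_subspace; apply: dim_geS (W2 i).
have not4 i : \dim (F i) != 4%N -> \dim (F i) = 3%N.
  by move=> Fi; apply/eqP; rewrite eqn_leq F3 andbT -ltnS ltn_neqAle Fi F4.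
have planeE i : \dim (F i) = 3%N -> W i = lin_subspace (F i).
  exact: lin_subspace_dim_ge_eq.
have planeW i : \dim (F i) = 3%N -> is_plane (W i).
  by move=> Fi; exists (F i) => //; apply: planeE.
(* Grassmann's formula again: [F i + F j] lies in the span of the union of the two components, of
   vector dimension at most 5. All of condition ii) is read off from this inequality. *)
have cap i j : (\dim (F i) + \dim (F j) <= 5 + \dim (F i :&: F j))%N.
  rewrite -dimv_sum_cap leq_add2r.
  have [T TE] := lin_spanE (W i `|` W j).
  apply: leq_trans (_ : \dim T <= 5)%N; last first.
    by apply/dim_le_lin_subspace; rewrite -TE.
  by apply: dimvS; rewrite subv_add; apply/andP; split; apply/lin_subspaceP;
    rewrite -FE -TE; (apply: sub_smallest2r; first by exists T) => ?; [left|right].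
have meet i j : \dim (F i) = 3%N -> \dim (F j) = 3%N -> W i `&` W j !=set0.
  move=> Fi Fj; rewrite !planeE //; apply/lin_subspaceI_nonempty.
  by have := cap i j; rewrite Fi Fj (leq_add2l 5 1).
pose A i := \dim (F i) == 4%N.
have [A0|/existsNP[i0 Fi0]] := pselect (forall i, \dim (F i) = 3%N).
  by left; split=> [i|i j]; [apply: planeW|apply: meet].
(* [t] counts the components spanning a projective 3-space; [i0] is one of them, so [t] is at least
   1. *)
right; have [s sA] := perm_separating A; exists s, #|A|.
have lo (i : 'I_r) : (i < #|A|)%N -> \dim (F (s i)) = 4%N by rewrite sA => /eqP.
have hi (i : 'I_r) : (#|A| <= i)%N -> \dim (F (s i)) = 3%N.
  by rewrite leqNgt sA => /not4.
split.
- have -> : (#|A| <= r)%N by rewrite -[leqRHS]card_ord max_card.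
  rewrite andbT; apply/card_gt0P; exists i0.
  by apply/negPn/negP => /not4.
- split=> i /= it; last by apply: planeW; apply: hi.
  split; last exact: span3.
  by rewrite FE; apply/dim_ge_lin_subspace; rewrite lo.
- split=> i j /= it jt.
  + rewrite !FE lin_subspaceI; apply/dim_ge_lin_subspace.
    by have := cap (s i) (s j); rewrite !lo // (leq_add2l 5 3).
  + rewrite FE planeE ?hi // lin_subspaceI; apply/dim_ge_lin_subspace.
    by have := cap (s i) (s j); rewrite lo // hi // (leq_add2l 5 2).
  + by apply: meet; apply: hi.
Qed.
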